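(* Let $(\Omega,\mathcal{F})$ be a standard measurable space, $T:\Omega\to\Omega$ a measurable transformation and $V$ a $T$-invariant upper probability. Let $\{f_n\}_{n\in\mathbb{N}}$ be $\mathcal{F}$-measurable functions such that (i) there exists $\lambda>0$ with $-\lambda n\le f_n(\omega)\le\lambda n$ for all $n\in\mathbb{N}$, $\omega\in\Omega$; (ii) for all $k,n\in\mathbb{N}$, $f_{n+k}\le f_n+f_k\circ T^n$ $V$-a.s. Then there exists a bounded $\mathcal{I}$-measurable function $f^*:\Omega\to\mathbb{R}$ such that $\lim_{n\to\infty}\frac{1}{n}f_n(\omega)=f^*(\omega)$ for $V$-a.s. $\omega\in\Omega$. If, in addition, $V$ is ergodic, then $f^*$ is constant $V$-a.s.
   Context: A measurable space is standard if isomorphic to a complete separable metric space with its Borel $\sigma$-algebra. A capacity is a monotone map $\mu:\mathcal{F}\to[0,1]$ with $\mu(\emptyset)=0,\mu(\Omega)=1$. An upper probability is a capacity $V$ with $V(A)=\max_{P\in\Lambda}P(A)$ for a weak* (setwise convergence) compact set $\Lambda$ of probabilities. $V$ is $T$-invariant if $V(T^{-1}A)=V(A)$. $\mathcal{I}=\{A\in\mathcal{F}:T^{-1}A=A\}$. $V$ is ergodic if for every $B\in\mathcal{I}$, $V(B)\in\{0,1\}$ and ($V(B)=0$ or $V(B^c)=0$). A property holds $V$-a.s. if it holds on a set $A\in\mathcal{F}$ with $V(A^c)=0$. *)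

(* Defs.v *)
From HB Require Import structures.
From mathcomp Require Import all_boot all_order all_algebra.
From mathcomp Require Import all_classical all_reals all_analysis.
Set Implicit Arguments. Unset Strict Implicit. Unset Printing Implicit Defensive.
Import Order.TTheory GRing.Theory Num.Theory.
Local Open Scope classical_set_scope.
Local Open Scope ring_scope.

Definition standard_space {d} {R : realType} (Omega : measurableType d) : Prop :=
  exists (M : completePseudoMetricType R),
    hausdorff_space M /\
    (exists D : set M, countable D /\ dense D) /\
    exists phi : Omega -> M, bijective phi /\
      forall A : set Omega,
        measurable A <-> <<s [set U : set M | open U] >> (phi @` A).

Definition capacity {d} {R : realType} (Omega : measurableType d)
    (V : set Omega -> \bar R) : Prop :=
  [/\ forall A B, measurable A -> measurable B -> A `<=` B -> (V A <= V B)%E,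
      V set0 = 0%E & V setT = 1%E].

(** The vector of values of a probability on measurable sets (0 elsewhere);
    the weak* (setwise convergence) topology on probabilities is the initial
    topology of this map into the pointwise (product) topology. *)
Definition setwise_values {d} {R : realType} (Omega : measurableType d)
    (P : probability Omega R) : {ptws set Omega -> \bar R} :=
  fun A => if `[< measurable A >] then P A else 0%E.

Definition setwise_compact {d} {R : realType} (Omega : measurableType d)
    (L : set (probability Omega R)) : Prop :=
  compact ((@setwise_values d R Omega) @` L).

Definition upper_probability {d} {R : realType} (Omega : measurableType d)
    (V : set Omega -> \bar R) : Prop :=
  capacity V /\
  exists L : set (probability Omega R),
    setwise_compact L /\
    forall A, measurable A ->
      (exists2 P, L P & V A = P A) /\ (forall P, L P -> (P A <= V A)%E).

Definition T_invariant {d} {R : realType} (Omega : measurableType d)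
    (T : Omega -> Omega) (V : set Omega -> \bar R) : Prop :=
  forall A, measurable A -> V (T @^-1` A) = V A.

Definition invariant_set {d} (Omega : measurableType d) (T : Omega -> Omega)
    (A : set Omega) : Prop :=
  measurable A /\ T @^-1` A = A.

Definition ergodic {d} {R : realType} (Omega : measurableType d)
    (T : Omega -> Omega) (V : set Omega -> \bar R) : Prop :=
  forall B, invariant_set T B ->
    (V B = 0%E \/ V B = 1%E) /\ (V B = 0%E \/ V (~` B) = 0%E).

Definition V_as {d} {R : realType} (Omega : measurableType d)
    (V : set Omega -> \bar R) (P : Omega -> Prop) : Prop :=
  exists A : set Omega, [/\ measurable A, V (~` A) = 0%E & A `<=` P].

Definition I_measurable {d} {R : realType} (Omega : measurableType d)
    (T : Omega -> Omega) (f : Omega -> R) : Prop :=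
  forall B : set R, measurable B -> invariant_set T (f @^-1` B).

(* Main.v *)
Require Import Defs.
From HB Require Import structures.
From mathcomp Require Import all_boot all_order all_algebra.
From mathcomp Require Import all_classical all_reals all_analysis.
From mathcomp Require Import measurable_realfun lra.
Import Order.TTheory GRing.Theory Num.Theory.
Import numFieldNormedType.Exports.
Local Open Scope classical_set_scope.
Local Open Scope ring_scope.
Set Implicit Arguments.
Unset Strict Implicit.
Unset Printing Implicit Defensive.

(** The probabilities representing [V] need not be [T]-invariant, and no
    invariant measure is used. Compactness makes [V] continuous from above at
    the empty set; hence a measurable set that every orbit visits only finitely
    often is [V]-null. Averaging [P (T^-j A) <= V A] along orbits gives a
    maximal inequality: the points all of whose iterates see [B] with frequency
    at least [delta] over some initial block form a set of upper probability at
    most [V B / delta].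

    Modifying [f] on a null set makes it subadditive everywhere. Then
    [G := liminf f_n / n] increases along every orbit to an invariant limit
    [G*], and each set [{G <= q < G*}] is visited finitely often, so [G = G*]
    almost surely. Tiling an orbit by blocks on which [f_m / m] is nearly at
    most [G*] bounds [limsup f_n / n] by [G*], up to the frequency of visits to
    a set of small [V], which the maximal inequality controls. *)

Lemma natmul_bounded_le0 (R : archiRealFieldType) (x y : R) :
  (forall n, n%:R * x <= y) -> x <= 0.
Proof.
move=> xy; rewrite leNgt; apply/negP => x0.
have [n _ /(_ n (leqnn n))] := nbhs_infty_gtr (y / x).
by rewrite ltr_pdivrMr// ltNge xy.
Qed.

Lemma norm_bounded_fun (T : Type) (R : realType) (u : T -> R^o) (M : R) :
  (forall x, `|u x| <= M) -> bounded_fun u.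
Proof.
move=> uM; exists M; split=> [|N MN x _]; first exact: num_real.
exact: le_trans (uM x) (ltW MN).
Qed.

Section limn_inf.
Context {R : realType}.
Implicit Types (u v : R^o^nat) (y M : R).

Lemma lt_limn_inf_near u y :
  bounded_fun u -> y < limn_inf u -> \forall n \near \oo, y < u n.
Proof.
move=> bu; rewrite limn_infE// => /sup_gt[|_ [N _ <-] yN].
  by exists (infs u 0%N); exists 0%N.
exists N => // n /= Nn; apply: lt_le_trans yN _.
by apply: ge_inf; [exact/has_lbound_sdrop/bounded_fun_has_lbound|exists n].
Qed.

Lemma limn_inf_lt_exists u y N :
  bounded_fun u -> limn_inf u < y -> exists2 n, (N <= n)%N & u n < y.
Proof.
move=> bu uy; have infs_lt : infs u N < y.
  apply: le_lt_trans uy; rewrite limn_infE//.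
  by apply: ub_le_sup; [exact: bounded_fun_has_ubound_infs|exists N].
have sdrop_neq0 : sdrop u N !=set0 by exists (u N), N => /=.
by have [_ [n Nn <-] uny] := inf_lt sdrop_neq0 infs_lt; exists n.
Qed.

Lemma norm_limn_inf_le u M : (forall n, `|u n| <= M) -> `|limn_inf u| <= M.
Proof.
move=> uM; have bu := norm_bounded_fun uM.
rewrite ler_norml; apply/andP; split; rewrite leNgt; apply/negP => lt.
  have [n _ un] := limn_inf_lt_exists 0%N bu lt.
  by have := uM n; rewrite ler_norml leNgt un.
have [N _ /(_ N (leqnn N)) uN] := lt_limn_inf_near bu lt.
by have := uM N; rewrite ler_norml andbC leNgt uN.
Qed.

Lemma le_limn_inf_shift u v (eps : R^nat) :
  bounded_fun u -> bounded_fun v -> eps @ \oo --> 0 ->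
  (forall n, u n.+1 <= v n + eps n) -> limn_inf u <= limn_inf v.
Proof.
move=> bu bv eps0 uv; rewrite leNgt; apply/negP => vu.
pose e := (limn_inf u - limn_inf v) / 3.
have e0 : 0 < e by rewrite /e; lra.
have [N1 _ uN1] : \forall n \near \oo, limn_inf u - e < u n.
  by apply: lt_limn_inf_near => //; lra.
have [N2 _ epsN2] := cvgr_lt _ eps0 _ e0.
have [n] := @limn_inf_lt_exists v (limn_inf v + e) (maxn N1 N2) bv ltac:(lra).
rewrite geq_max => /andP[N1n N2n] vn.
have := uN1 n.+1 (leqW N1n); have := epsN2 n N2n; have := uv n.
by rewrite /e in vn *; lra.
Qed.

Lemma measurable_fun_limn_inf d (Omega : measurableType d) (D : set Omega)
    (h : nat -> Omega -> R) :
  (forall x, D x -> bounded_fun (h ^~ x : R^o^nat)) ->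
  (forall n, measurable_fun D (h n)) ->
  measurable_fun D (fun x => limn_inf (h ^~ x)).
Proof.
move=> bh mh.
apply: (measurable_fun_cvg (h := fun n x => infs (h ^~ x) n)) => [n|x Dx].
  by apply: measurable_fun_infs => // x /bh; exact: bounded_fun_has_lbound.
rewrite limn_infE; last exact: bh.
by apply: cvg_infs_sup;
  [exact/bounded_fun_has_ubound/bh|exact/bounded_fun_has_lbound/bh].
Qed.

End limn_inf.

Lemma setwise_compact_lower_bound d (R : realType) (Omega : measurableType d)
    (L : set (probability Omega R))
    (Q_ : nat -> probability Omega R) (A : nat -> set Omega) (e : \bar R) :
  setwise_compact L -> (forall n, L (Q_ n)) -> (forall k, measurable (A k)) ->
  (forall k, \forall n \near \oo, (e <= Q_ n (A k))%E) ->
  exists2 Q, L Q & forall k, (e <= Q (A k))%E.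
Proof.
move=> cL LQ_ mA eQ_; pose F := (fun n => setwise_values (Q_ n)) @ \oo.
have [_ [[Q LQ <-] clQ]] : @setwise_values d R Omega @` L `&` cluster F !=set0.
  by apply: cL; exists 0%N => // n _; exists (Q_ n).
exists Q => // k; rewrite leNgt; apply/negP => Qe.
have FA : F [set v | (e <= v (A k))%E].
  by apply: filterS (eQ_ k) => n; rewrite /= /setwise_values asboolT.
have nQ : nbhs (setwise_values Q) [set v | (v (A k) < e)%E].
  apply: (@proj_continuous _ _ (A k) (setwise_values Q) [set x | (x < e)%E]).
  apply: open_nbhs_nbhs; split; first exact: open_ereal_lt_ereal.
  by rewrite /= /setwise_values /proj asboolT.
have [v [/= ev ve]] := clQ _ _ FA nQ.
by have := le_lt_trans ev ve; rewrite ltxx.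
Qed.

Section upper_probability_theory.
Context d (R : realType) (Omega : measurableType d) (V : set Omega -> \bar R).
Hypothesis UV : upper_probability V.
Implicit Types (A B D : set Omega) (P : Omega -> Prop).

Lemma upper_probability_attained A : measurable A ->
  exists2 Q : probability Omega R,
    V A = Q A & forall B, measurable B -> (Q B <= V B)%E.
Proof.
move=> mA; have [_ [L [_ VL]]] := UV; have [[Q LQ VA] _] := VL _ mA.
by exists Q => // B mB; have [_] := VL _ mB; exact.
Qed.

Lemma upper_probability_ge0 A : measurable A -> (0 <= V A)%E.
Proof. by move=> /upper_probability_attained[Q -> _]. Qed.

Lemma upper_probability_fin_num A : measurable A -> V A \is a fin_num.
Proof.
by move=> /[dup] mA /upper_probability_attained[Q -> _]; exact: fin_num_measure.
Qed.

Lemma le_upper_probability A B :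
  measurable A -> measurable B -> A `<=` B -> (V A <= V B)%E.
Proof. by case: UV => -[mono _ _] _; exact: mono. Qed.

Lemma upper_probability_eq0 A :
  measurable A -> (forall e : R, 0 < e -> (V A <= e%:E)%E) -> V A = 0%E.
Proof.
move=> mA Ae; apply/eqP; rewrite eq_le upper_probability_ge0// andbT.
by apply/lee_addgt0Pr => e /Ae; rewrite add0e.
Qed.

Lemma upper_probabilityU A B :
  measurable A -> measurable B -> (V (A `|` B) <= V A + V B)%E.
Proof.
move=> mA mB; have mAB := measurableU _ _ mA mB.
have [Q -> QV] := upper_probability_attained mAB.
by apply: le_trans (measureU2 Q mA mB) _; apply: leeD; exact: QV.
Qed.

Lemma upper_probability_bigcup0 (A : nat -> set Omega) :
  (forall n, measurable (A n)) -> (forall n, V (A n) = 0%E) ->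
  V (\bigcup_n A n) = 0%E.
Proof.
move=> mA VA; have mU : measurable (\bigcup_n A n) by exact: bigcupT_measurable.
have [Q -> QV] := upper_probability_attained mU.
apply/(negligibleP Q mU); apply: negligible_bigcup => n.
by apply/(negligibleP Q (mA n))/eqP; rewrite eq_le measure_ge0 -(VA n) QV.
Qed.

Lemma upper_probability_nonincreasing_lt (A : nat -> set Omega) (e : R) :
  (forall n, measurable (A n)) -> nonincreasing_seq A ->
  \bigcap_n A n = set0 -> 0 < e -> \forall n \near \oo, (V (A n) < e%:E)%E.
Proof.
move=> mA dA A0 e0; have AS k n : (k <= n)%N -> A n `<=` A k.
  by move=> kn; exact/subsetPset/dA.
suff [N VN] : exists n, (V (A n) < e%:E)%E.
  exists N => // n /= Nn; apply: le_lt_trans VN.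
  by apply: le_upper_probability => //; exact: AS.
apply: contrapT => /forallNP noV; have [_ [L [cL VL]]] := UV.
have /choice[Q_ Q_P] n : exists Q, L Q /\ V (A n) = Q (A n).
  by have [[Q LQ VQ] _] := VL _ (mA n); exists Q.
have [Q _ eQ] : exists2 Q, L Q & forall k, (e%:E <= Q (A k))%E.
  apply: (setwise_compact_lower_bound cL (fun n => (Q_P n).1) mA) => k.
  exists k => // n /= kn; apply: (@le_trans _ _ (Q_ n (A n))).
    by rewrite -(Q_P n).2 leNgt; exact/negP.
  by apply: le_measure; rewrite ?inE//; exact: AS.
have QA : Q \o A @ \oo --> 0%E.
  rewrite -(measure0 Q) -A0; apply: nonincreasing_cvg_mu => //.
    by rewrite (le_lt_trans (probability_le1 _ _))// ltey.
  by rewrite A0.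
suff : (e%:E <= 0)%E by rewrite lee_fin leNgt e0.
by apply: cvge_ge QA; exact: nearW.
Qed.

Lemma upper_probability_setD_bigcup_lt D (A : nat -> set Omega) (e : R) :
  measurable D -> (forall n, measurable (A n)) -> D `<=` \bigcup_n A n ->
  0 < e -> \forall N \near \oo, (V (D `\` \bigcup_(n < N) A n) < e%:E)%E.
Proof.
move=> mD mA DA; apply: upper_probability_nonincreasing_lt.
- by move=> N; apply: measurableD => //; exact: bigcup_measurable.
- move=> M N MN; apply/subsetPset; apply: setDS => w [n /= nM Anw].
  by exists n => //; exact: leq_trans MN.
- rewrite -subset0 => w Dw; have [n _ Anw] := DA w (Dw 0%N I).1.
  by case: (Dw n.+1 I) => _ []; exists n => /=.
Qed.

Lemma V_as_null_setC A : measurable A -> V A = 0%E -> V_as V (~` A).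
Proof.
by move=> mA VA; exists (~` A); rewrite setCK; split => //; exact: measurableC.
Qed.

Lemma V_as_forall_nat (P_ : nat -> Omega -> Prop) :
  (forall n, V_as V (P_ n)) -> V_as V (fun w => forall n, P_ n w).
Proof.
move=> /choice[A AP]; exists (\bigcap_n A n); split.
- by apply: bigcapT_measurable => n; have [] := AP n.
- rewrite setC_bigcap; apply: upper_probability_bigcup0 => n.
    by apply: measurableC; have [] := AP n.
  by have [] := AP n.
- by move=> w Aw n; have [_ _] := AP n; apply; exact: Aw.
Qed.

#[local] Instance V_as_proper_filter : ProperFilter (V_as V).
Proof.
have [[_ V0 VT] _] := UV; split.
  move=> [A [_ + A0]]; have -> : A = set0 by rewrite -subset0.
  by rewrite setC0 VT => /eqP; rewrite onee_eq0.
split.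
- by exists setT; rewrite setCT.
- move=> P Q asP asQ.
  have [A [mA VA AP]] := @V_as_forall_nat (fun n => if n is 0%N then P else Q)
    (fun n => if n is 0%N then asP else asQ).
  by exists A; split => // w /AP h; split; [exact: (h 0%N)|exact: (h 1%N)].
- move=> P Q PQ [A [mA VA AP]]; exists A; split => //.
  exact: subset_trans PQ.
Qed.

Lemma V_as_forall (I : countType) (P_ : I -> Omega -> Prop) :
  (forall i, V_as V (P_ i)) -> V_as V (fun w => forall i, P_ i w).
Proof.
move=> asP; pose P' n w := if unpickle n is Some i then P_ i w else True.
have asP' : V_as V (fun w => forall n, P' n w).
  apply: V_as_forall_nat => n; rewrite /P'.
  by case: unpickle => [i|]; [exact: asP|exact: filterT].
by apply: filterS asP' => w P'w i; have := P'w (pickle i); rewrite /P' pickleK.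
Qed.

End upper_probability_theory.

Section orbits.
Context {R : realType} {Omega : Type} (T : Omega -> Omega).
Implicit Types (B D : set Omega) (f : nat -> Omega -> R) (c g : Omega -> R).

Definition visits B (n : nat) (w : Omega) : R := \sum_(j < n) \1_B (iter j T w).

Definition subadditive_cocycle f : Prop :=
  forall m n w, f (m + n)%N w <= f m w + f n (iter m T w).

Definition unreached f c (N : nat) : set Omega :=
  ~` \bigcup_(n < N) [set w | f n.+1 w <= c w * n.+1%:R].

Definition frequent_visits B (delta : R) : set Omega :=
  [set w | forall i, exists n, delta * n.+1%:R <= visits B n.+1 (iter i T w)].

Lemma le_iter g n w : (forall x, g x <= g (T x)) -> g w <= g (iter n T w).
Proof. by move=> gT; elim: n => //= n /le_trans; apply. Qed.

Lemma forward_invariant_iter D n w :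
  D `<=` T @^-1` D -> D w -> D (iter n T w).
Proof. by move=> DT Dw; elim: n => //= n /DT. Qed.

Lemma visits_ge0 B n w : 0 <= visits B n w.
Proof. by apply: sumr_ge0 => j _; rewrite indicE. Qed.

Lemma visits_le B n w : visits B n w <= n%:R.
Proof.
rewrite -[n in leRHS]card_ord -sumr_const.
by apply: ler_sum => j _; rewrite indicE lern1 leq_b1.
Qed.

Lemma visits_subset B D n w : B `<=` D -> visits B n w <= visits D n w.
Proof.
move=> BD; apply: ler_sum => j _; rewrite !indicE ler_nat.
by have [/set_mem/BD/mem_set ->|] := boolP (_ \in B).
Qed.

Lemma visitsD B m n w :
  visits B (m + n)%N w = visits B m w + visits B n (iter m T w).
Proof.
rewrite /visits big_split_ord /=; congr (_ + _).
by apply: eq_bigr => j _; rewrite addnC iterD.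
Qed.

Lemma visits_not_frequent B (delta : R) w :
  0 <= delta -> ~ frequent_visits B delta w ->
  exists i, forall n, visits B n w <= i%:R + delta * n%:R.
Proof.
move=> d0 /existsNP[i /forallNP infrequent]; exists i => n.
have [ni|/ltnW ni] := leqP n i.
  apply: le_trans (visits_le _ _ _) _.
  by rewrite -[leLHS]addr0 lerD ?ler_nat// mulr_ge0.
rewrite -(subnKC ni) visitsD; apply: lerD; first exact: visits_le.
apply: (@le_trans _ _ (delta * (n - i)%:R)); last first.
  by rewrite ler_wpM2l// ler_nat leq_addl.
case: (n - i)%N => [|k]; first by rewrite /visits big_ord0 mulr0.
by rewrite leNgt; apply/negP => /ltW/infrequent.
Qed.

(* Cover the orbit of [w] by blocks of length at most [N] on which the average
   is at most [c], single steps at the points of [unreached f c N], and a last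
   block of length at most [N]. *)
Lemma subadditive_tiling f c (K : R) (N n : nat) w :
  subadditive_cocycle f -> (forall x, c (T x) <= c x) -> 0 <= K ->
  (forall m x, f m x <= (c x + K) * m%:R) ->
  f n w <= c w * n%:R + K * (visits (unreached f c N) n w + N%:R).
Proof.
move=> fsub cT K0 fcK; set B := unreached f c N.
have c_iter m x : c (iter m T x) <= c x.
  by rewrite -lerN2; apply: (le_iter (g := \- c)) => y; rewrite lerN2.
elim/ltn_ind: n w => n IH w; have [nN|Nn] := leqP n N.
  apply: le_trans (fcK n w) _; rewrite mulrDl lerD2l ler_wpM2l//.
  by rewrite -[leLHS]add0r lerD ?visits_ge0// ler_nat.
suff [m [k [m0 nE fm]]] : exists m k, [/\ (0 < m)%N, n = (m + k)%N &
    f m w <= c w * m%:R + K * visits B m w].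
  have kn : (k < n)%N by rewrite nE -[ltnLHS]add0n ltn_add2r.
  have fk := IH k kn (iter m T w).
  have ck := ler_wpM2r (ler0n R k) (c_iter m w).
  by rewrite nE visitsD natrD; apply: le_trans (fsub m k w) _; lra.
have [Bw|/contrapT[m mN fm]] := pselect (B w); last first.
  exists m.+1, (n - m.+1)%N; split => //.
    by rewrite subnKC// (leq_trans mN (ltnW Nn)).
  by apply: le_trans fm _; rewrite lerDl mulr_ge0// visits_ge0.
exists 1%N, n.-1; split => //; first by rewrite add1n (ltn_predK Nn).
by rewrite /visits big_ord1 indicE mem_set// -mulrDl fcK.
Qed.

Lemma visits_lower_bound B D (delta : R) (N n : nat) w :
  0 <= delta -> D `<=` T @^-1` D ->
  (forall x, D x ->
     exists2 m, (m < N)%N & delta * m.+1%:R <= visits B m.+1 x) ->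
  delta * n%:R * \1_D w <= visits B n w + delta * N%:R.
Proof.
move=> d0 DT Dvisits.
pose f m x : R := - visits B m x; pose c x : R := - (delta * \1_D x).
have fsub : subadditive_cocycle f by move=> m k x; rewrite /f visitsD opprD.
have cT x : c (T x) <= c x.
  rewrite lerN2 ler_wpM2l//.
  have := @visits_subset D (T @^-1` D) 1%N x DT.
  by rewrite /visits !big_ord1.
have fcd m x : f m x <= (c x + delta) * m%:R.
  apply: (@le_trans _ _ 0); first by rewrite oppr_le0 visits_ge0.
  by rewrite mulr_ge0// addrC subr_ge0 ler_piMr.
have tiled := subadditive_tiling N n w fsub cT d0 fcd.
rewrite indicE; case: (boolP (w \in D)) => [/set_mem Dw|_]; last first.
  by rewrite mulr0 addr_ge0 ?visits_ge0// mulr_ge0.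
have all_reached : visits (unreached f c N) n w = 0.
  apply: big1 => j _; rewrite indicE memNset//.
  have Dj := forward_invariant_iter j DT Dw.
  have [m mN Bm] := Dvisits _ Dj; apply; exists m => //=.
  by rewrite /f /c indicE mem_set// mulr1 mulNr lerN2.
by move: tiled; rewrite all_reached add0r /f /c indicE mem_set//; lra.
Qed.

End orbits.

Section measurable_comparison_sets.
Context d (R : realType) (Omega : measurableType d) (g h : Omega -> R).
Hypotheses (mg : measurable_fun setT g) (mh : measurable_fun setT h).

Lemma measurable_set_le : measurable [set w | g w <= h w].
Proof. by rewrite -[X in measurable X]setTI; exact: measurable_fun_le. Qed.

Lemma measurable_set_lt : measurable [set w | g w < h w].
Proof.
rewrite (_ : [set w | _] = ~` [set w | h w <= g w]).
  apply: measurableC; rewrite -[X in measurable X]setTI.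
  exact: measurable_fun_le.
by apply/seteqP; split => w /=; rewrite ltNge => /negP.
Qed.

End measurable_comparison_sets.

Section invariant_upper_probability.
Context d (R : realType) (Omega : measurableType d) (T : Omega -> Omega)
  (V : set Omega -> \bar R).
Hypotheses (mT : measurable_fun setT T) (UV : upper_probability V)
  (TV : T_invariant T V).
Implicit Types (A B D : set Omega) (P : Omega -> Prop).
Implicit Types (f : nat -> Omega -> R) (c g : Omega -> R).

Let V_as_filter : ProperFilter (V_as V) := V_as_proper_filter UV.
#[local] Existing Instance V_as_filter.

Lemma measurable_iter n : measurable_fun setT (iter n T).
Proof.
elim: n => [|n IH]; first exact: measurable_id.
exact: measurableT_comp mT IH.
Qed.

Lemma measurable_preimage_iter n A :
  measurable A -> measurable (iter n T @^-1` A).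
Proof.
by move=> mA; rewrite -[X in measurable X]setTI; exact: measurable_iter.
Qed.

Lemma measurable_visits B n :
  measurable B -> measurable_fun setT (visits T B n : Omega -> R).
Proof.
move=> mB; apply: measurable_sum => j.
exact: measurableT_comp (measurable_indic mB) (measurable_iter j).
Qed.

Lemma measurable_frequent_visits B (delta : R) :
  measurable B -> measurable (frequent_visits T B delta).
Proof.
move=> mB; rewrite [frequent_visits _ _ _](_ : _ = \bigcap_i (iter i T @^-1`
    \bigcup_n [set w | delta * n.+1%:R <= visits T B n.+1 w])).
  apply: bigcapT_measurable => i; apply: measurable_preimage_iter.
  apply: bigcupT_measurable => n.
  by apply: measurable_set_le => //; exact: measurable_visits.
apply/seteqP; split=> w freq i; first by have [n] := freq i; exists n.
by have [n _] := freq i I; exists n.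
Qed.

Lemma T_invariant_iter n A : measurable A -> V (iter n T @^-1` A) = V A.
Proof.
move=> mA; elim: n => [//|n <-].
rewrite -(TV (measurable_preimage_iter n mA)).
by congr V; apply/seteqP; split => w /=; rewrite -iterSr.
Qed.

Lemma V_as_forward_invariant_set P : V_as V P ->
  exists E, [/\ measurable E, V (~` E) = 0%E, E `<=` T @^-1` E & E `<=` P].
Proof.
move=> [A [mA VA AP]]; exists (\bigcap_i (iter i T @^-1` A)); split.
- by apply: bigcapT_measurable => i; exact: measurable_preimage_iter.
- have mAC := measurableC mA; rewrite setC_bigcap.
  apply: upper_probability_bigcup0 => // i; rewrite preimage_setC.
    exact: measurable_preimage_iter.
  by rewrite T_invariant_iter.
- by move=> w Aw i _; rewrite /preimage/= -iterSr; exact: Aw.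
- by move=> w Aw; apply: AP; exact: Aw 0%N I.
Qed.

Lemma finitely_visited_null A : measurable A ->
  (forall w, \forall n \near \oo, ~ A (iter n T w)) -> V A = 0%E.
Proof.
move=> mA Afin; pose U n := \bigcup_(j >= n) (iter j T @^-1` A).
have mU n : measurable (U n).
  by apply: bigcup_measurable => j _; exact: measurable_preimage_iter.
apply: upper_probability_eq0 => // e e0.
have [||n _ /(_ n (leqnn n))/ltW] :=
  upper_probability_nonincreasing_lt UV mU _ _ e0.
- move=> m n mn; apply/subsetPset => w [j /= nj Aj].
  by exists j => //=; exact: leq_trans nj.
- rewrite -subset0 => w Uw; have [n _ nA] := Afin w.
  by have [j /= /nA] := Uw n I.
apply: le_trans; rewrite -(T_invariant_iter n mA).
apply: le_upper_probability => //; first exact: measurable_preimage_iter.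
by move=> w Aw; exists n => /=.
Qed.

Lemma integral_visits_le (Q : probability Omega R) B n :
  measurable B -> (forall A, measurable A -> (Q A <= V A)%E) ->
  (\int[Q]_w (visits T B n w)%:E <= n%:R%:E * V B)%E.
Proof.
move=> mB QV; under eq_integral do rewrite -sumEFin.
rewrite ge0_integral_sum//; last first.
  move=> j; apply/measurable_EFinP.
  exact: measurableT_comp (measurable_indic mB) (measurable_iter j).
have -> : (n%:R%:E * V B = \sum_(j < n) V B)%E.
  by rewrite mule_natl sumr_const card_ord.
apply: lee_sum => j _; rewrite -(T_invariant_iter j mB).
have mBj := measurable_preimage_iter j mB.
by rewrite (integral_indic Q measurableT mBj) setIT; exact: QV.
Qed.

Lemma upper_probability_le_visits D B (a k : R) n :
  measurable D -> measurable B -> 0 <= a -> 0 <= k ->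
  (forall w, a * \1_D w <= visits T B n w + k) ->
  (a%:E * V D <= n%:R%:E * V B + k%:E)%E.
Proof.
move=> mD mB a0 k0 DB.
have [Q -> QV] := upper_probability_attained UV mD.
have mvB : measurable_fun setT (fun w => (visits T B n w : R)%:E).
  by apply/measurable_EFinP; exact: measurable_visits.
have -> : (a%:E * Q D = \int[Q]_w (a * \1_D w)%:E)%E.
  rewrite (integralZl_indic measurableT (fun=> D)) ?integral_indic ?setIT//.
  by rewrite ltNge a0.
apply: (@le_trans _ _ (\int[Q]_w ((visits T B n w)%:E + k%:E))%E).
  apply: ge0_le_integral => //.
  - by move=> w _; rewrite lee_fin mulr_ge0.
  - by apply/measurable_EFinP; exact: measurable_funM.
  - exact: emeasurable_funD.
  - by move=> w _; rewrite -EFinD lee_fin.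
rewrite ge0_integralD// => [|w _]; last by rewrite lee_fin visits_ge0.
rewrite integral_cst// [X in (_ * X)%E]probability_setT mule1 leeD2r//.
exact: integral_visits_le.
Qed.

Lemma upper_probability_ge_frequency D B (delta : R) N :
  measurable D -> measurable B -> 0 <= delta -> D `<=` T @^-1` D ->
  (forall w, D w ->
     exists2 n, (n < N)%N & delta * n.+1%:R <= visits T B n.+1 w) ->
  (delta%:E * V D <= V B)%E.
Proof.
move=> mD mB d0 DT Dvisits.
have average n :
    ((delta * n%:R)%:E * V D <= n%:R%:E * V B + (delta * N%:R)%:E)%E.
  apply: upper_probability_le_visits; rewrite ?mulr_ge0// => w.
  exact: visits_lower_bound.
have finV A : measurable A -> V A = (fine (V A))%:E.
  by move=> mA; rewrite fineK// upper_probability_fin_num.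
rewrite (finV D)// (finV B)// -EFinM lee_fin -subr_le0.
apply: (natmul_bounded_le0 (y := delta * N%:R)) => n.
by have := average n; rewrite (finV D)// (finV B)// -!EFinM -EFinD lee_fin; lra.
Qed.

(* The points of [D] that need more than [N] steps to see [B] with frequency
   [delta] form a small set, which is added to [B]. *)
Lemma maximal_inequality B (delta : R) : measurable B -> 0 < delta ->
  (delta%:E * V (frequent_visits T B delta) <= V B)%E.
Proof.
move=> mB d0; set D := frequent_visits T B delta.
have [d1|d1] := ltP 1 delta.
  have D0 : D = set0.
    rewrite -subset0 => w /(_ 0%N)[n]; rewrite leNgt => /negP; apply.
    apply: le_lt_trans (visits_le _ _ _ _) _.
    by rewrite -[ltLHS]mul1r ltr_pM2r.
  by have [[_ V0 _] _] := UV; rewrite D0 V0 mule0 upper_probability_ge0.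
have mD : measurable D by exact: measurable_frequent_visits.
pose A n := [set w | delta * n.+1%:R <= visits T B n.+1 w].
have mA n : measurable (A n).
  by apply: measurable_set_le => //; exact: measurable_visits.
have DA : D `<=` \bigcup_n A n by move=> w /(_ 0%N)[n]; exists n.
apply/lee_addgt0Pr => e e0.
have [N _ /(_ N (leqnn N)) VN] :=
  upper_probability_setD_bigcup_lt UV mD mA DA e0.
set C := _ `\` _ in VN.
have mC : measurable C by apply: measurableD => //; exact: bigcup_measurable.
apply: (@le_trans _ _ (V (B `|` C))); last first.
  by apply: le_trans (upper_probabilityU UV mB mC) _; rewrite leeD2l// ltW.
apply: (@upper_probability_ge_frequency _ _ _ N.+1) => //.
- exact: measurableU.
- exact: ltW.
- by move=> w Dw i; have := Dw i.+1; rewrite iterSr.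
- move=> w Dw; have [[n nN Anw]|nA] := pselect ((\bigcup_(n < N) A n) w).
    exists n; first exact: ltnW.
    by apply: le_trans Anw _; apply: visits_subset; exact: subsetUl.
  exists 0%N => //; rewrite mulr1 (le_trans d1)//.
  by rewrite /visits big_ord1 indicE mem_set//; right.
Qed.

Lemma V_as_infrequent_visits (B : nat -> set Omega) (delta : R) :
  (forall N, measurable (B N)) ->
  (forall e : R, 0 < e -> \forall N \near \oo, (V (B N) < e%:E)%E) ->
  0 < delta ->
  V_as V (fun w => exists N i : nat,
    forall n, visits T (B N) n w <= i%:R + delta * n%:R).
Proof.
move=> mB VB d0; pose D N := frequent_visits T (B N) delta.
have mD N : measurable (D N) by exact: measurable_frequent_visits.
have VD : V (\bigcap_N D N) = 0%E.
  apply: upper_probability_eq0 => // [|e e0]; first exact: bigcapT_measurable.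
  have [N _ /(_ N (leqnn N)) VN] := VB _ (mulr_gt0 d0 e0).
  apply: (@le_trans _ _ (V (D N))).
    apply: le_upper_probability => //; first exact: bigcapT_measurable.
    exact: bigcap_inf.
  have := le_lt_trans (maximal_inequality (mB N) d0) VN.
  by rewrite EFinM lte_pmul2l// => /ltW.
apply: filterS (V_as_null_setC (bigcapT_measurable mD) VD) => w.
move=> /existsNP[N /not_implyP[_ nDN]].
by exists N; exact: visits_not_frequent (ltW d0) nDN.
Qed.

Lemma subadditive_affine_bound f c (K delta : R) :
  subadditive_cocycle T f -> (forall n, measurable_fun setT (f n)) ->
  (forall w, c (T w) <= c w) -> measurable_fun setT c ->
  0 <= K -> (forall n w, f n w <= (c w + K) * n%:R) ->
  (forall w, exists n, f n.+1 w <= c w * n.+1%:R) -> 0 < delta ->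
  V_as V (fun w => exists C, forall n, f n w <= (c w + K * delta) * n%:R + C).
Proof.
move=> fsub mf cT mc K0 fcK fc d0.
pose A n := [set w | f n.+1 w <= c w * n.+1%:R].
have mA n : measurable (A n).
  by apply: measurable_set_le => //; exact: measurable_funM.
have mB N : measurable (unreached f c N).
  by apply: measurableC; apply: bigcup_measurable => n _; exact: mA.
have cover : setT `<=` \bigcup_n A n by move=> w _; have [n] := fc w; exists n.
have VB e : 0 < e -> \forall N \near \oo, (V (unreached f c N) < e%:E)%E.
  move=> e0.
  apply: filterS (upper_probability_setD_bigcup_lt UV measurableT mA cover e0).
  by move=> N; rewrite setTD.
apply: filterS (V_as_infrequent_visits mB VB d0) => w [N [i visits_le_i]].
exists (K * (i%:R + N%:R)) => n.
apply: le_trans (subadditive_tiling N n w fsub cT K0 fcK) _.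
by have := ler_wpM2l K0 (visits_le_i n); lra.
Qed.

Lemma subadditive_eventually_le f c (K : R) :
  subadditive_cocycle T f -> (forall n, measurable_fun setT (f n)) ->
  (forall w, c (T w) <= c w) -> measurable_fun setT c ->
  0 <= K -> (forall n w, f n w <= (c w + K) * n%:R) ->
  (forall w e, 0 < e -> exists n, f n.+1 w <= (c w + e) * n.+1%:R) ->
  V_as V (fun w =>
    forall e, 0 < e -> \forall n \near \oo, f n w / n%:R <= c w + e).
Proof.
move=> fsub mf cT mc K0 fcK fc.
have affine (k : nat) : V_as V (fun w => exists C, forall n,
    f n w <= (c w + k.+1%:R^-1 + K * k.+1%:R^-1) * n%:R + C).
  apply: (@subadditive_affine_bound f (fun w => c w + k.+1%:R^-1)) => //.
  - by move=> w; rewrite lerD2r.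
  - exact: measurable_funD.
  - move=> n w; apply: le_trans (fcK n w) _; rewrite ler_wpM2r//.
    by rewrite lerD2r lerDl invr_ge0.
  - by move=> w; apply: fc; rewrite invr_gt0.
apply: filterS (V_as_forall UV affine) => w affine_w e e0.
have e2 : 0 < e / (2 * (1 + K)) by rewrite divr_gt0// mulr_gt0// ltr_pwDl.
have [k _ /(_ k (leqnn k)) /= ke] := near_infty_natSinv_lt (PosNum e2).
have [C fC] := affine_w k; set t := k.+1%:R^-1 in ke fC.
have te : t + K * t <= e / 2.
  rewrite -{1}[t]mul1r -mulrDl mulrC -ler_pdivlMr ?ltr_pwDl//.
  by rewrite -mulrA -invfM ltW.
near=> n.
have n0 : 0 < n%:R :> R by rewrite ltr0n; near: n; exact: nbhs_infty_gt.
have Cn : C <= e / 2 * n%:R.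
  by rewrite mulrC -ler_pdivrMr ?divr_gt0//; near: n; exact: nbhs_infty_ger.
rewrite ler_pdivrMr//; apply: le_trans (fC n) _.
by have := ler_wpM2r (ltW n0) te; lra.
Unshelve. all: by end_near. Qed.

End invariant_upper_probability.

Section orbit_limits.
Context (R : realType) (Omega : Type) (T : Omega -> Omega).
Variables (g : Omega -> R) (M : R).
Hypotheses (gT : forall w, g w <= g (T w)) (gM : forall w, `|g w| <= M).

Definition orbit_lim (w : Omega) : R := limn (fun i => g (iter i T w)).

Lemma orbit_nondecreasing w : nondecreasing_seq (fun i => g (iter i T w)).
Proof. by move=> i j ij; rewrite -(subnK ij) iterD; exact: le_iter. Qed.

Lemma cvg_orbit_lim w : g (iter i T w) @[i --> \oo] --> orbit_lim w.
Proof.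
apply: nondecreasing_is_cvgn (@orbit_nondecreasing w) _.
by exists M => _ [i _ <-]; exact: le_trans (ler_norm _) (gM _).
Qed.

Lemma le_orbit_lim w : g w <= orbit_lim w.
Proof.
exact: (nondecreasing_cvgn_le (@orbit_nondecreasing w) (@cvg_orbit_lim w) 0%N).
Qed.

Lemma orbit_lim_invariant w : orbit_lim (T w) = orbit_lim w.
Proof.
apply/cvg_lim => //; have := @cvg_orbit_lim w.
by rewrite -cvg_shiftS /=; under eq_cvg do rewrite -iterS iterSr.
Qed.

Lemma norm_orbit_lim_le w : `|orbit_lim w| <= M.
Proof.
have gM_iter i : - M <= g (iter i T w) <= M by rewrite -ler_norml.
rewrite ler_norml; apply/andP; split.
  apply: limr_ge; first exact: cvg_orbit_lim.
  by apply: nearW => i; case/andP: (gM_iter i).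
apply: limr_le; first exact: cvg_orbit_lim.
by apply: nearW => i; case/andP: (gM_iter i).
Qed.

End orbit_limits.

Section measurable_orbit_limits.
Context d (R : realType) (Omega : measurableType d) (T : Omega -> Omega).
Variables (g : Omega -> R) (M : R).
Hypotheses (gT : forall w, g w <= g (T w)) (gM : forall w, `|g w| <= M).
Hypotheses (mT : measurable_fun setT T) (mg : measurable_fun setT g).

Lemma measurable_orbit_lim : measurable_fun setT (orbit_lim T g).
Proof.
apply: (measurable_fun_cvg (h := fun i w => g (iter i T w))) => [i|w _].
  exact: measurableT_comp mg (measurable_iter mT i).
exact: (cvg_orbit_lim gT gM (w := w)).
Qed.

Lemma I_measurable_orbit_lim : I_measurable T (orbit_lim T g).
Proof.
move=> Y mY; split.
  by rewrite -[X in measurable X]setTI; exact: measurable_orbit_lim.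
by apply/seteqP; split => w /=; rewrite (orbit_lim_invariant gT gM).
Qed.

(* As [g] increases along orbits, each orbit eventually leaves the sets
   [{g <= q < orbit_lim T g}], which are therefore null. *)
Lemma V_as_orbit_lim_le (V : set Omega -> \bar R) :
  upper_probability V -> T_invariant T V ->
  V_as V (fun w => orbit_lim T g w <= g w).
Proof.
move=> UV TV; have VF := V_as_proper_filter UV.
pose A (q : rat) :=
  [set w | g w <= ratr q] `&` [set w | ratr q < orbit_lim T g w].
have mA q : measurable (A q).
  apply: measurableI; first exact: measurable_set_le.
  by apply: measurable_set_lt => //; exact: measurable_orbit_lim.
have VA q : V (A q) = 0%E.
  apply: (finitely_visited_null mT UV TV) => // w.
  have [q_lt|le_q] := ltP (ratr q) (orbit_lim T g w).
    apply: filterS (cvgr_gt _ (cvg_orbit_lim gT gM (w := w)) _ q_lt) => i.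
    by rewrite ltNge => /negP + [].
  apply: nearW => i [_ /=]; apply/negP; rewrite -leNgt.
  by elim: i => //= i; rewrite (orbit_lim_invariant gT gM).
apply: filterS (V_as_forall UV (fun q => V_as_null_setC (mA q) (VA q))) => w nA.
rewrite leNgt; apply/negP => /rat_in_itvoo[q].
rewrite in_itv /= => /andP[gq ql].
by apply: (nA q); split => //; exact: ltW.
Qed.

End measurable_orbit_limits.

Lemma ergodic_I_measurable_cst d (R : realType) (Omega : measurableType d)
    (T : Omega -> Omega) (V : set Omega -> \bar R) (g : Omega -> R) :
  upper_probability V -> I_measurable T g -> ergodic T V ->
  exists c, V_as V (fun w => g w = c).
Proof.
move=> UV Ig erg; have VF := V_as_proper_filter UV.
pose A (q : rat) := [set w | g w < ratr q].
have IA q : invariant_set T (A q).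
  rewrite (_ : A q = g @^-1` `]-oo, ratr q[%classic); first exact: Ig.
  by apply/seteqP; split => w /=; rewrite in_itv.
have zero_one q : exists b : bool, V_as V (fun w => (g w < ratr q) = b).
  have [mA _] := IA q; have [_ [VA|VA]] := erg _ (IA q).
    by exists false; apply: filterS (V_as_null_setC mA VA) => w /negP/negbTE.
  by exists true, (A q); split.
have {zero_one}[b as_b] := choice zero_one.
have /[dup] as_all_b := V_as_forall UV as_b.
move=> /filter_ex[w0 w0b]; exists (g w0).
apply: filterS as_all_b => w wb; apply/eqP; rewrite eq_le !leNgt.
apply/andP; split; apply/negP => /rat_in_itvoo[q]; rewrite in_itv /= => /andP[].
  by move=> + /ltW; rewrite leNgt (w0b q) -(wb q) => -> .
by move=> + /ltW; rewrite leNgt (wb q) -(w0b q) => ->.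
Qed.

Lemma subadditive_modification d (R : realType) (Omega : measurableType d)
    (T : Omega -> Omega) (V : set Omega -> \bar R) (f : nat -> Omega -> R)
    (lam : R) :
  measurable_fun setT T -> upper_probability V -> T_invariant T V ->
  (forall n, measurable_fun setT (f n)) -> 0 <= lam ->
  (forall n w, (0 < n)%N -> `|f n w| <= lam * n%:R) ->
  (forall m n, (0 < m)%N -> (0 < n)%N ->
     V_as V (fun w => f (m + n)%N w <= f m w + f n (iter m T w))) ->
  exists h : nat -> Omega -> R,
    [/\ forall n, measurable_fun setT (h n),
        forall n w, `|h n w| <= lam * n%:R,
        subadditive_cocycle T h
      & V_as V (fun w => forall n, (0 < n)%N -> h n w = f n w)].
Proof.
move=> mT UV TV mf lam0 flam fsub.
have [E [mE VE ET Esub]] := V_as_forward_invariant_set mT UV TV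
  (V_as_forall UV (fun m => V_as_forall UV (fun n => fsub m.+1 n.+1 isT isT))).
pose h n w := if (0 < n)%N && (w \in E) then f n w else - (lam * n%:R).
have h0 w : h 0%N w = 0 by rewrite /h /= mulr0 oppr0.
have hE n w : (0 < n)%N -> E w -> h n w = f n w.
  by move=> n0 Ew; rewrite /h n0 mem_set.
have hlam n w : `|h n w| <= lam * n%:R.
  rewrite /h; case: ifP => [/andP[n0 _]|_]; first exact: flam.
  by rewrite normrN ger0_norm ?mulr_ge0.
exists h; split => //.
- move=> [|n]; first by apply: measurable_cst.
  apply: measurable_fun_ifT => //.
  by apply: (measurable_fun_bool true); rewrite setTI preimage_mem_true.
- move=> [|m] [|n] w; rewrite ?add0n ?addn0 ?h0 ?add0r ?addr0//.
  have [Ew|nEw] := pselect (E w).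
    by rewrite !hE//; [exact: Esub|exact: forward_invariant_iter].
  rewrite /h memNset//= natrD mulrDr opprD lerD2l.
  by have := hlam n.+1 (iter m.+1 T w); rewrite ler_norml => /andP[].
- by exists E; split => // w Ew n n0; exact: hE.
Qed.

Section subadditive_ergodic.
Context d (R : realType) (Omega : measurableType d) (T : Omega -> Omega)
  (V : set Omega -> \bar R).
Variables (f : nat -> Omega -> R) (lam : R).
Hypotheses (mT : measurable_fun setT T) (UV : upper_probability V)
  (TV : T_invariant T V) (mf : forall n, measurable_fun setT (f n))
  (lam0 : 0 <= lam) (flam : forall n w, `|f n w| <= lam * n%:R)
  (fsub : subadditive_cocycle T f).

Definition liminf_average (w : Omega) : R := limn_inf (fun n => f n w / n%:R).

Lemma norm_average_le n w : `|f n w / n%:R| <= lam.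
Proof.
case: n => [|n]; first by rewrite invr0 mulr0 normr0.
by rewrite normrM normfV [`|n.+1%:R|]ger0_norm// ler_pdivrMr// flam.
Qed.

Lemma norm_liminf_average_le w : `|liminf_average w| <= lam.
Proof. by apply: norm_limn_inf_le => n; exact: norm_average_le. Qed.

Lemma bounded_average w : bounded_fun (fun n => f n w / n%:R : R^o).
Proof. by apply: norm_bounded_fun => n; exact: norm_average_le. Qed.

Lemma measurable_liminf_average : measurable_fun setT liminf_average.
Proof.
apply: (measurable_fun_limn_inf (h := fun n w => f n w / n%:R)) => [w _|n].
  exact: bounded_average.
exact: measurable_funM.
Qed.

Lemma liminf_average_le w : liminf_average w <= liminf_average (T w).
Proof.
apply: (le_limn_inf_shift (eps := fun n => 2 * lam * n.+1%:R^-1)).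
- exact: bounded_average.
- exact: bounded_average.
- by rewrite -[0](mulr0 (2 * lam)); apply: cvgMr; exact: cvg_harmonic.
move=> n; apply: (@le_trans _ _ ((f 1 w + f n (T w)) / n.+1%:R)).
  by rewrite ler_pM2r ?invr_gt0//; exact: fsub 1%N n w.
rewrite ler_pdivrMr// mulrDl divfK// -natr1 mulrDr mulr1.
have fnE : f n (T w) = f n (T w) / n%:R * n%:R.
  have [->|n0] := posnP n; last by rewrite divfK// pnatr_eq0 -lt0n.
  by apply/eqP; rewrite mulr0 -normr_le0 (le_trans (flam _ _))// mulr0.
have := flam 1 w; have := norm_average_le n (T w).
by rewrite !ler_norml -fnE; lra.
Qed.

Let fstar : Omega -> R := orbit_lim T liminf_average.

Lemma V_as_average_near_le : V_as V (fun w =>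
  forall e, 0 < e -> \forall n \near \oo, f n w / n%:R <= fstar w + e).
Proof.
have [GT Glam] := (liminf_average_le, norm_liminf_average_le).
apply: (subadditive_eventually_le mT UV TV (K := 2 * lam)) => //.
- by move=> w; rewrite /fstar (orbit_lim_invariant GT Glam).
- exact: measurable_orbit_lim GT Glam mT measurable_liminf_average.
- by rewrite mulr_ge0.
- move=> n w; apply: le_trans (ler_norm _) _; apply: le_trans (flam n w) _.
  rewrite ler_wpM2r//; have := norm_orbit_lim_le GT Glam w.
  by rewrite ler_norml -/(fstar w); lra.
- move=> w e e0; have Ge : liminf_average w < fstar w + e.
    apply: le_lt_trans (_ : fstar w < _); last by rewrite ltrDl.
    exact: (le_orbit_lim GT Glam).
  have [[//|n] _ fn] := limn_inf_lt_exists 1%N (@bounded_average w) Ge.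
  by exists n; rewrite -ler_pdivrMr// ltW.
Qed.

Lemma V_as_cvg_average :
  V_as V (fun w => f n w / n%:R @[n --> \oo] --> fstar w).
Proof.
have VF := V_as_proper_filter UV.
have [GT Glam] := (liminf_average_le, norm_liminf_average_le).
have fstar_le := V_as_orbit_lim_le GT Glam mT measurable_liminf_average UV TV.
apply: filterS2 V_as_average_near_le fstar_le => w upper lower.
apply/cvgrPdist_le => e e0.
have eG : fstar w - e < liminf_average w.
  by apply: lt_le_trans lower; rewrite ltrBlDr ltrDl.
apply: filterS2 (upper e e0) (lt_limn_inf_near (@bounded_average w) eG) => n.
by rewrite ler_distlC => -> /ltW ->.
Qed.

Lemma subadditive_ergodic : exists fstar : Omega -> R,
  [/\ I_measurable T fstar, forall w, `|fstar w| <= lam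
    & V_as V (fun w => f n w / n%:R @[n --> \oo] --> fstar w)].
Proof.
have [GT Glam] := (liminf_average_le, norm_liminf_average_le).
exists fstar; split; last exact: V_as_cvg_average.
- exact: I_measurable_orbit_lim GT Glam mT measurable_liminf_average.
- exact: norm_orbit_lim_le GT Glam.
Qed.

End subadditive_ergodic.

Theorem theorem7p1 (d : measure_display) (R : realType)
    (Omega : measurableType d) (T : Omega -> Omega) (V : set Omega -> \bar R)
    (f : nat -> Omega -> R) :
  standard_space (R := R) Omega ->
  measurable_fun setT T ->
  upper_probability V ->
  T_invariant T V ->
  (forall n, measurable_fun setT (f n)) ->
  (exists2 lam : R, 0 < lam &
     forall n w, (0 < n)%N -> - (lam * n%:R) <= f n w <= lam * n%:R) ->
  (forall k n, (0 < k)%N -> (0 < n)%N ->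
     V_as V (fun w => f (n + k)%N w <= f n w + f k (iter n T w))) ->
  exists fstar : Omega -> R,
    [/\ I_measurable T fstar,
        (exists M : R, forall w, `|fstar w| <= M),
        V_as V (fun w => (fun n => f n w / n%:R) @ \oo --> fstar w)
      & ergodic T V -> exists c : R, V_as V (fun w => fstar w = c)].
Proof.
move=> _ mT UV TV mf [lam lam0 flam] fsub; have VF := V_as_proper_filter UV.
have [n w n0|m n m0 n0|h [mh hlam hsub hf]] :=
  subadditive_modification mT UV TV mf (ltW lam0).
- by rewrite ler_norml flam.
- exact: fsub.
have [fstar [Ifstar fstar_lam cvg_h]] :=
  subadditive_ergodic mT UV TV mh (ltW lam0) hlam hsub.
exists fstar; split => //; [by exists lam| |exact: ergodic_I_measurable_cst].
apply: filterS2 hf cvg_h => w hfw; apply: cvg_trans; apply: near_eq_cvg.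
by near=> n; rewrite hfw//; near: n; exact: nbhs_infty_gt.
Unshelve. all: by end_near. Qed.
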